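(* Let $0<\beta<1$, $T>0$, $n_T$ a positive integer, $\tau=T/n_T$, $t_k=k\tau$. Let $\varpi_j$ be defined by $(1-z)^\beta=\sum_{j\ge0}\varpi_j z^j$, $\varrho_j$ by $(1-z)^{-\beta}=\sum_{j\ge0}\varrho_jz^j$, and $P_j:=\tau^\beta\varrho_j$. For a sequence $w^0,\dots,w^{n_T}$ define $D_\tau^{(\beta)}w^k=\tau^{-\beta}\sum_{j=0}^k\varpi_{k-j}(w^j-w^0)$, and for $\theta\in[0,1]$ set $w^{k-\theta}=(1-\theta)w^k+\theta w^{k-1}$ ($k\ge1$). Let $0\le\theta\le1$, and let $\{g^k\}_{k=0}^{n_T}$ and $\{\lambda_l\}_{l=0}^{n_T-1}$ be given non-negative sequences. Assume there is a constant $\lambda$ (independent of the time step size) with $\lambda\ge\sum_{l=0}^{k-1}\lambda_l$ for $1\le k\le n_T$, and that $$\tau\le \frac{1}{\sqrt[\beta]{2\lambda(1+\beta)}}.$$ Then for any non-negative sequence $\{v^k\}_{k=0}^{n_T}$ satisfying $$D_\tau^{(\beta)}(v^k)^2\le\sum_{l=1}^k\lambda_{k-l}(v^l)^2+v^{k-\theta}g^{k-\theta},\qquad 1\le k\le n_T,$$ (where $D_\tau^{(\beta)}(v^k)^2=\tau^{-\beta}\sum_{j=0}^k\varpi_{k-j}((v^j)^2-(v^0)^2)$) it holds that $$v^k\le 2E_\beta(2\lambda t_k^\beta)\Big(v^0+\max_{1\le m\le k}\sum_{j=1}^mP_{m-j}\,g^{j-\theta}\Big),\qquad 1\le k\le n_T,$$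 where $E_\beta(z)=\sum_{l=0}^\infty\frac{z^l}{\Gamma(1+l\beta)}$. *)

(* Defs.v *)
From Stdlib Require Import Reals Lra List.
From Coquelicot Require Import Coquelicot.
Open Scope R_scope.

(* sum_{j=a}^{b} f j  (empty, = 0, when b < a) *)
Definition rsum (a b : nat) (f : nat -> R) : R :=
  fold_right Rplus 0 (map f (seq a (S b - a))).

(* max_{1 <= m <= k} F m  (for k >= 1) *)
Definition rmax1 (k : nat) (F : nat -> R) : R :=
  fold_right Rmax (F 1%nat) (map F (seq 1 k)).

Fixpoint gbinom (a : R) (j : nat) : R :=
  match j with
  | O => 1
  | S i => gbinom a i * (a - INR i) / INR (S i)
  end.

(* Taylor coefficients:  (1-z)^beta = sum varpi_j z^j,  (1-z)^(-beta) = sum varrho_j z^j *)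
Definition varpi (beta : R) (j : nat) : R := (-1) ^ j * gbinom beta j.
Definition varrho (beta : R) (j : nat) : R := (-1) ^ j * gbinom (- beta) j.

Definition Pcoef (beta tau : R) (j : nat) : R := Rpower tau beta * varrho beta j.

Definition Gamma (s : R) : R :=
  RInt_gen (fun x => Rpower x (s - 1) * exp (- x)) (at_right 0) (Rbar_locally p_infty).

Definition MittagLeffler (beta z : R) : R :=
  Series (fun l => z ^ l / Gamma (1 + INR l * beta)).

Definition shifted (theta : R) (w : nat -> R) (k : nat) : R :=
  (1 - theta) * w k + theta * w (k - 1)%nat.

Definition Dfrac (beta tau : R) (w : nat -> R) (k : nat) : R :=
  Rpower tau (- beta) * rsum 0 k (fun j => varpi beta (k - j) * (w j - w 0%nat)).

(* Main.v *)
(* Convolving the inequality with P inverts the discrete fractional derivative, since (1-z)^(-beta) (1-z)^beta = 1. If v^n is at most some earlier value, induction and monotonicity of the bound suffice; otherwise all terms can be divided by v^n, and the claim reduces to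
     2 lambda sum_{k<n} P_{n-k} E_beta(2 lambda t_k^beta) <= E_beta(2 lambda t_n^beta) - 1,
   which holds term by term in the power series once
     sum_{0<k<n} varrho_{n-k} k^s / Gamma(1+s) <= n^(s+beta) / Gamma(1+s+beta).
   The Vandermonde convolution of the coefficients of (1-z)^(-beta) and (1-z)^(-1-s), combined with log-convexity of Gamma, gives this up to a shift n + O(1) on the right. The left side divided by n^(s+beta) does not decrease when n is replaced by m n, because varrho_j decreases while j^(1-beta) varrho_j increases; letting m tend to infinity removes the shift. *)
Require Import Defs.
From Stdlib Require Import Reals Arith List Lra Lia Classical.
From Coquelicot Require Import Coquelicot.
Open Scope R_scope.

(** * Finite sums *)

Lemma rsum_nil a b f : (b < a)%nat -> rsum a b f = 0.
Proof. intros H; unfold rsum; now replace (S b - a)%nat with 0%nat by lia. Qed.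

Lemma rsum_last a b f : (a <= S b)%nat -> rsum a (S b) f = rsum a b f + f (S b).
Proof.
  intros H; unfold rsum.
  replace (S (S b) - a)%nat with (S (S b - a)) by lia.
  rewrite seq_S, map_app, fold_right_app.
  replace (a + (S b - a))%nat with (S b) by lia.
  generalize (map f (seq a (S b - a))); intros s.
  cbn [map fold_right]; induction s as [|x s IH]; cbn [fold_right]; [|rewrite IH]; ring.
Qed.

Lemma rsum_single a f : rsum a a f = f a.
Proof. unfold rsum; replace (S a - a)%nat with 1%nat by lia; simpl; ring. Qed.

Lemma rsum_le a b f h :
  (forall i, (a <= i <= b)%nat -> f i <= h i) -> rsum a b f <= rsum a b h.
Proof.
  induction b as [|b IH]; intros H.
  - destruct a; [rewrite !rsum_single; apply H; lia|rewrite !rsum_nil by lia; lra].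
  - destruct (Compare_dec.le_lt_dec a (S b)) as [Hab|Hab].
    + rewrite !rsum_last by exact Hab.
      apply Rplus_le_compat; [apply IH; intros i Hi|]; apply H; lia.
    + rewrite !rsum_nil by exact Hab; lra.
Qed.

Lemma rsum_ext a b f h :
  (forall i, (a <= i <= b)%nat -> f i = h i) -> rsum a b f = rsum a b h.
Proof.
  intros H; apply Rle_antisym; apply rsum_le; intros i Hi; rewrite H by exact Hi; lra.
Qed.

Lemma rsum_plus a b f h : rsum a b (fun i => f i + h i) = rsum a b f + rsum a b h.
Proof.
  unfold rsum; induction (seq a (S b - a)) as [|x s IH]; simpl; [|rewrite IH]; ring.
Qed.

Lemma rsum_scal a b c f : rsum a b (fun i => c * f i) = c * rsum a b f.
Proof.
  unfold rsum; induction (seq a (S b - a)) as [|x s IH]; simpl; [|rewrite IH]; ring.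
Qed.

Lemma rsum_ge_const a b c f : (a <= S b)%nat ->
  (forall i, (a <= i <= b)%nat -> c <= f i) -> INR (S b - a) * c <= rsum a b f.
Proof.
  induction b as [|b IH]; intros Hab H.
  - destruct a as [|a]; [rewrite rsum_single; assert (c <= f 0%nat) by (apply H; lia); simpl; lra|].
    rewrite rsum_nil by lia; replace (1 - S a)%nat with 0%nat by lia; simpl; lra.
  - destruct (Nat.eq_dec a (S (S b))) as [->|Ha].
    + rewrite rsum_nil by lia; rewrite Nat.sub_diag; simpl; lra.
    + rewrite rsum_last by lia.
      replace (S (S b) - a)%nat with (S (S b - a)) by lia; rewrite S_INR.
      assert (c <= f (S b)) by (apply H; lia).
      assert (INR (S b - a) * c <= rsum a b f) by (apply IH; [lia|intros i Hi; apply H; lia]).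
      lra.
Qed.

Lemma rsum_nonneg a b f : (forall i, (a <= i <= b)%nat -> 0 <= f i) -> 0 <= rsum a b f.
Proof.
  intros H; destruct (Compare_dec.le_lt_dec a (S b)) as [Hab|Hab].
  - generalize (rsum_ge_const a b 0 f Hab H); lra.
  - rewrite rsum_nil by lia; lra.
Qed.

Lemma rsum_first a b f : (a <= b)%nat -> rsum a b f = f a + rsum (S a) b f.
Proof.
  intros H; unfold rsum; replace (S b - a)%nat with (S (S b - S a)) by lia; reflexivity.
Qed.

Lemma rsum_shift a b f : rsum (S a) (S b) f = rsum a b (fun i => f (S i)).
Proof.
  unfold rsum; replace (S (S b) - S a)%nat with (S b - a)%nat by lia.
  now rewrite <- seq_shift, map_map.
Qed.

Lemma rsum_shift_add j q f : rsum j (q + j) f = rsum 0 q (fun k => f (k + j)%nat).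
Proof.
  revert f; induction j as [|j IH]; intros f.
  - rewrite Nat.add_0_r; apply rsum_ext; intros k _; now rewrite Nat.add_0_r.
  - rewrite <- plus_n_Sm, rsum_shift, IH; apply rsum_ext; intros k _.
    now rewrite <- plus_n_Sm.
Qed.

Lemma rsum_chasles a b c f : (a <= S b)%nat -> (b <= c)%nat ->
  rsum a c f = rsum a b f + rsum (S b) c f.
Proof.
  intros Hab Hbc; induction Hbc as [|c Hbc IH].
  - rewrite (rsum_nil (S b) b) by lia; ring.
  - rewrite !rsum_last, IH by lia; ring.
Qed.

Lemma rsum_rev n f : rsum 0 n (fun i => f (n - i)%nat) = rsum 0 n f.
Proof.
  induction n as [|n IH]; [now rewrite !rsum_single|].
  rewrite rsum_first, rsum_shift, rsum_last by lia.
  rewrite <- IH, Nat.sub_0_r; simpl; ring.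
Qed.

(** Fubini on the triangle [j <= k <= n], the form needed to reorder a composition of two
    convolutions. *)
Lemma rsum_triangle n (f : nat -> nat -> R) :
  rsum 0 n (fun k => rsum 0 k (f k)) = rsum 0 n (fun j => rsum j n (fun k => f k j)).
Proof.
  induction n as [|n IH]; [now rewrite !rsum_single|].
  rewrite (rsum_last 0 n), (rsum_last 0 n (fun j => rsum j (S n) _)), IH by lia.
  rewrite rsum_single, (rsum_last 0 n (f (S n))) by lia.
  rewrite (rsum_ext 0 n (fun j => rsum j (S n) _)
     (fun j => rsum j n (fun k => f k j) + f (S n) j)).
  - rewrite rsum_plus; ring.
  - intros j Hj; rewrite rsum_last by lia; ring.
Qed.

(** * Binomial coefficients and their convolutions *)

Lemma varrho_0 a : varrho a 0 = 1.
Proof. unfold varrho; simpl; ring. Qed.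

(** Coefficient form of the differential equation [(1 - z) y' = a y] satisfied by
    [y = (1 - z)^(-a)]. *)
Lemma varrho_S a j : INR (S j) * varrho a (S j) = (a + INR j) * varrho a j.
Proof.
  unfold varrho; cbn [gbinom pow]; field; apply not_0_INR; lia.
Qed.

Lemma varrho_pos a j : 0 < a -> 0 < varrho a j.
Proof.
  intros Ha; induction j as [|j IH]; [rewrite varrho_0; lra|].
  apply Rmult_lt_reg_l with (INR (S j)); [apply lt_0_INR; lia|].
  rewrite Rmult_0_r, varrho_S; apply Rmult_lt_0_compat; [|exact IH].
  generalize (pos_INR j); lra.
Qed.

Lemma varrho_zero j : varrho 0 (S j) = 0.
Proof.
  induction j as [|j IH]; [unfold varrho; simpl; field|].
  apply Rmult_eq_reg_l with (INR (S (S j))); [|apply not_0_INR; lia].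
  rewrite varrho_S, IH; ring.
Qed.

Lemma varpi_varrho b j : varpi b j = varrho (- b) j.
Proof. unfold varpi, varrho; now rewrite Ropp_involutive. Qed.

(* Coefficient form of (1-z)^(-a) (1-z)^(-b) = (1-z)^(-(a+b)). *)
Lemma varrho_vandermonde a b n :
  rsum 0 n (fun k => varrho a (n - k) * varrho b k) = varrho (a + b) n.
Proof.
  induction n as [|n IH]; [rewrite rsum_single, !varrho_0; ring|].
  assert (HS : INR (S n) <> 0) by (apply not_0_INR; lia).
  apply Rmult_eq_reg_l with (INR (S n)); [|exact HS].
  rewrite varrho_S, <- IH, <- rsum_scal, <- rsum_scal.
  (* Split the factor [S n] as [(S n - k) + k]. In each part the recurrence lowers one index, giving
     convolutions at level [n] with weights [a + (n - k)] and [b + k], whose sum is [a + b + n]. *)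
  transitivity (rsum 0 (S n) (fun k => INR (S n - k) * varrho a (S n - k) * varrho b k)
    + rsum 0 (S n) (fun k => varrho a (S n - k) * (INR k * varrho b k))).
  { rewrite <- rsum_plus; apply rsum_ext; intros k Hk.
    rewrite minus_INR by lia; ring. }
  rewrite rsum_last, (rsum_first 0 (S n)), rsum_shift by lia.
  rewrite Nat.sub_diag; simpl (INR 0).
  rewrite !Rmult_0_l, Rmult_0_r, Rplus_0_r, Rplus_0_l, <- rsum_plus.
  apply rsum_ext; intros k Hk.
  rewrite varrho_S; replace (S n - k)%nat with (S (n - k)) by lia.
  rewrite varrho_S, minus_INR by lia; simpl (S n - S k)%nat; ring.
Qed.

(** The powers of [tau] cancel. After reordering, [w j - w 0] is multiplied by the coefficient of
    index [m - j] in [(1 - z)^0 = 1], so only [j = m] survives. *)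
Lemma sum_Pcoef_Dfrac beta tau w m :
  rsum 1 m (fun k => Pcoef beta tau (m - k) * Dfrac beta tau w k) = w m - w 0%nat.
Proof.
  destruct m as [|m]; [rewrite rsum_nil by lia; ring|].
  transitivity (rsum 0 (S m) (fun k => rsum 0 k (fun j =>
      varrho beta (S m - k) * (varrho (- beta) (k - j) * (w j - w 0%nat))))).
  (* The outer sum may start at 0: the added term carries the factor [w 0 - w 0]. *)
  - rewrite (rsum_first 0 (S m)), rsum_single, Rminus_diag, !Rmult_0_r, Rplus_0_l by lia.
    apply rsum_ext; intros k _; unfold Pcoef, Dfrac.
    rewrite rsum_scal, Rpower_Ropp.
    rewrite (rsum_ext 0 k (fun j => varpi _ _ * _)
       (fun j => varrho (- beta) (k - j) * (w j - w 0%nat)))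
      by (intros; now rewrite varpi_varrho).
    field; apply Rgt_not_eq, exp_pos.
  - rewrite rsum_triangle, rsum_last by lia.
    rewrite rsum_single, !Nat.sub_diag, !varrho_0.
    rewrite (rsum_ext 0 m _ (fun _ => 0 * 0)); [rewrite rsum_scal; ring|].
    intros j Hj.
    rewrite (rsum_ext j (S m) _ (fun k => (w j - w 0%nat) *
       (varrho beta (S m - k) * varrho (- beta) (k - j)))) by (intros; ring).
    rewrite rsum_scal.
    replace (S m) with (S (m - j) + j)%nat at 1 by lia.
    rewrite rsum_shift_add.
    rewrite (rsum_ext 0 (S (m - j)) _
      (fun k => varrho beta (S (m - j) - k) * varrho (- beta) k)).
    + rewrite varrho_vandermonde, Rplus_opp_r, varrho_zero; ring.
    + intros k Hk; do 2 f_equal; lia.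
Qed.

(** * Maxima over initial segments *)

Lemma rmax1_ge k F m : (1 <= m <= k)%nat -> F m <= rmax1 k F.
Proof.
  intros H; unfold rmax1; generalize (F 1%nat); intros x.
  assert (Hin : In (F m) (map F (seq 1 k))) by (apply in_map, in_seq; lia).
  induction (map F (seq 1 k)) as [|y s IH]; simpl; [contradiction|].
  destruct Hin as [->|Hin]; [apply Rmax_l|].
  eapply Rle_trans; [apply IH, Hin|apply Rmax_r].
Qed.

Lemma rmax1_le k F M : (1 <= k)%nat ->
  (forall m, (1 <= m <= k)%nat -> F m <= M) -> rmax1 k F <= M.
Proof.
  intros Hk H; unfold rmax1.
  assert (H1 : F 1%nat <= M) by (apply H; lia).
  assert (Hs : forall y, In y (map F (seq 1 k)) -> y <= M).
  { intros y Hy; apply in_map_iff in Hy; destruct Hy as [m [<- Hm]].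
    apply in_seq in Hm; apply H; lia. }
  induction (map F (seq 1 k)) as [|y s IH]; simpl; [exact H1|].
  apply Rmax_lub; [apply Hs; now left|apply IH; intros z Hz; apply Hs; now right].
Qed.

Lemma rmax1_monotone j k F : (1 <= j <= k)%nat -> rmax1 j F <= rmax1 k F.
Proof.
  intros H; apply rmax1_le; [lia|intros m Hm; apply rmax1_ge; lia].
Qed.

(** * Bernoulli inequalities and the Gamma function *)

Lemma exp_le x y : x <= y -> exp x <= exp y.
Proof. intros [H| ->]; [apply Rlt_le, exp_increasing, H|apply Rle_refl]. Qed.

Lemma Rpower_pos x p : 0 < Rpower x p.
Proof. apply exp_pos. Qed.

Lemma Rpower_1_base p : Rpower 1 p = 1.
Proof. unfold Rpower; rewrite ln_1, Rmult_0_r; apply exp_0. Qed.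

Lemma ln_le_minus_1 x : 0 < x -> ln x <= x - 1.
Proof.
  intros Hx; generalize (exp_ineq1_le (ln x)); rewrite exp_ln by exact Hx; lra.
Qed.

(** Concavity of [ln]: its tangent line at [y] is evaluated at [t] and at 1, and the two bounds are
    averaged with weights [p] and [1 - p]. The linear terms cancel because [y] is the corresponding
    mean, leaving [p * ln t <= ln y]. *)
Lemma Rpower_bernoulli_le t p : 0 < t -> 0 <= p <= 1 -> Rpower t p <= 1 + p * (t - 1).
Proof.
  intros Ht Hp; set (y := 1 + p * (t - 1)).
  assert (Hy : 0 < y) by (unfold y; nra).
  assert (Hty : ln t - ln y <= t / y - 1).
  { rewrite <- ln_div by assumption; apply ln_le_minus_1, Rdiv_lt_0_compat; assumption. }
  assert (H1y : - ln y <= / y - 1).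
  { rewrite <- ln_Rinv by assumption; apply ln_le_minus_1, Rinv_0_lt_compat, Hy. }
  assert (H : p * (t / y) + (1 - p) * / y = 1) by (unfold y in *; field; lra).
  rewrite <- (exp_ln y Hy); unfold Rpower; apply exp_le; nra.
Qed.

(** For [p <= 0] this combines [1 + x <= exp x] with [ln t <= t - 1]. For [1 <= p] the concave case
    is applied with exponent [/ p] to the base [1 + p * (t - 1)], and the result is raised to the
    power [p]. *)
Lemma Rpower_bernoulli_ge t p : 0 < t -> p <= 0 \/ 1 <= p -> 1 + p * (t - 1) <= Rpower t p.
Proof.
  intros Ht [Hp|Hp].
  - apply Rle_trans with (1 + p * ln t); [|apply exp_ineq1_le].
    generalize (ln_le_minus_1 t Ht); nra.
  - destruct (Rle_lt_dec (1 + p * (t - 1)) 0) as [Hy|Hy];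
      [generalize (Rpower_pos t p); lra|].
    assert (Hip : 0 <= / p <= 1).
    { split; [apply Rlt_le, Rinv_0_lt_compat; lra|].
      rewrite <- Rinv_1; apply Rinv_le_contravar; lra. }
    generalize (Rpower_bernoulli_le _ _ Hy Hip); intros H.
    replace (1 + / p * (1 + p * (t - 1) - 1)) with t in H by (field; lra).
    revert Hy H; generalize (1 + p * (t - 1)); intros y Hy H.
    rewrite <- (Rpower_1 y), <- (Rinv_l p), <- Rpower_mult by lra.
    apply Rle_Rpower_l; [lra|split; [apply Rpower_pos|exact H]].
Qed.

(** Monotone convergence: the improper integral is the supremum of the integrals over compact
    intervals. The second conjunct later yields lower bounds for [Gamma]. *)
Lemma is_RInt_gen_nonneg_bounded (f : R -> R) M :
  (forall x, 0 < x -> continuous f x) -> (forall x, 0 < x -> 0 <= f x) ->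
  (forall a b, 0 < a <= b -> RInt f a b <= M) ->
  exists l, is_RInt_gen f (at_right 0) (Rbar_locally p_infty) l /\
    forall a b, 0 < a <= b -> RInt f a b <= l.
Proof.
  intros Hc Hpos HM.
  assert (Hex : forall a b, 0 < a -> 0 < b -> ex_RInt f a b).
  { intros a b Ha Hb; apply (ex_RInt_continuous (V := R_CompleteNormedModule)); intros z Hz; apply Hc.
    apply Rlt_le_trans with (Rmin a b); [apply Rmin_glb_lt; assumption|tauto]. }
  assert (Hpos' : forall a b, 0 < a <= b -> 0 <= RInt f a b).
  { intros a b Hab; apply RInt_ge_0; [tauto|apply Hex; lra|intros x Hx; apply Hpos; lra]. }
  set (E := fun y => exists a b, 0 < a <= b /\ y = RInt f a b).
  destruct (completeness E) as [l [Hub Hlub]].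
  - exists M; intros y [a [b [Hab ->]]]; apply HM, Hab.
  - exists (RInt f 1 1), 1, 1; split; [lra|reflexivity].
  - exists l; split; [|intros a b Hab; apply Hub; exists a, b; tauto].
    intros P [eps HP].
    (* An interval nearly attaining the supremum; any interval containing it has an integral between
       [l - eps] and [l]. *)
    assert (Hnot : exists a b, 0 < a <= b /\ l - eps < RInt f a b).
    { apply NNPP; intros Hno.
      assert (l <= l - eps); [|generalize (cond_pos eps); lra].
      apply Hlub; intros y [a [b [Hab ->]]].
      apply Rnot_lt_le; intros Hlt; apply Hno; exists a, b; tauto. }
    destruct Hnot as [a0 [b0 [Hab0 H0]]].
    apply (Filter_prod _ _ _ (fun a => 0 < a < a0) (fun b => b0 < b)).
    + exists (mkposreal a0 (proj1 Hab0)); intros a Ha Ha0; split; [exact Ha0|].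
      generalize (Rabs_lt_between' a 0 a0); intros [H _].
      assert (Rabs (a - 0) < a0) as Hlt by exact Ha; apply H in Hlt; lra.
    + exists b0; tauto.
    + intros a b Ha Hb; exists (RInt f a b); split.
      * apply (RInt_correct (V := R_CompleteNormedModule)), Hex; simpl; lra.
      * apply HP; apply Rabs_def1.
        -- change (RInt f a b - l < eps).
           assert (RInt f a b <= l); [|generalize (cond_pos eps); lra].
           apply Hub; exists a, b; split; [lra|reflexivity].
        -- change (- eps < RInt f a b - l).
           assert (RInt f a0 b0 <= RInt f a b); [|lra].
           rewrite <- (RInt_Chasles f a a0 b), <- (RInt_Chasles f a0 b0 b)
             by (apply Hex; lra).
           assert (0 <= RInt f a a0) by (apply Hpos'; lra).
           assert (0 <= RInt f b0 b) by (apply Hpos'; lra).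
           unfold plus; simpl; lra.
Qed.

(** Taking [f] as its own majorant in the norm inequality for improper integrals gives
    [norm l <= l]. *)
Lemma is_RInt_gen_nonneg (f : R -> R) l : (forall x, 0 < x -> 0 <= f x) ->
  is_RInt_gen f (at_right 0) (Rbar_locally p_infty) l -> 0 <= l.
Proof.
  intros Hpos Hf.
  apply Rle_trans with (norm l); [apply norm_ge_0|].
  apply (RInt_gen_norm (Fa := at_right 0) (Fb := Rbar_locally p_infty) f f); [| |exact Hf|exact Hf].
  - apply (Filter_prod _ _ _ (fun a => 0 < a < 1) (fun b => 1 < b)).
    + exists (mkposreal 1 Rlt_0_1); intros a Ha Ha0; split; [exact Ha0|].
      assert (Rabs (a - 0) < 1) as Hlt by exact Ha; apply Rabs_def2 in Hlt; lra.
    + exists 1; tauto.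
    + simpl; intros; lra.
  - apply (Filter_prod _ _ _ (fun a => 0 < a) (fun b => True)).
    + exists (mkposreal 1 Rlt_0_1); tauto.
    + exists 0; tauto.
    + simpl; intros a b Ha _ x Hx; unfold norm; simpl.
      unfold abs; simpl; rewrite Rabs_pos_eq; [lra|apply Hpos; lra].
Qed.

(** * The Gamma integral: convergence, functional equation, convexity *)

Definition Gamma_density (s x : R) : R := Rpower x (s - 1) * exp (- x).

Lemma Gamma_density_continuous s x : 0 < x -> continuous (Gamma_density s) x.
Proof.
  intros Hx; apply (ex_derive_continuous (K := R_AbsRing) (V := R_NormedModule)).
  unfold Gamma_density, Rpower; auto_derive; exact Hx.
Qed.

Lemma Gamma_density_pos s x : 0 < Gamma_density s x.
Proof. apply Rmult_lt_0_compat; apply exp_pos. Qed.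

Lemma Gamma_density_le s : 1 <= s ->
  exists C, 0 < C /\ forall x, 0 < x -> Gamma_density s x <= C * exp (- x / 2).
Proof.
  (* The tangent bound [ln x - ln c <= x / c], multiplied by [s - 1], stays below [x / 2] as soon as
     [c >= 2 * (s - 1)]; the extra 1 keeps [c] positive when [s = 1]. *)
  intros Hs; set (c := 2 * (s - 1) + 1).
  assert (Hc : 0 < c) by (unfold c; lra).
  exists (exp ((s - 1) * ln c)); split; [apply exp_pos|intros x Hx].
  unfold Gamma_density, Rpower; rewrite <- !exp_plus; apply exp_le.
  assert (H : ln x - ln c <= x / c).
  { rewrite <- ln_div by assumption.
    generalize (ln_le_minus_1 _ (Rdiv_lt_0_compat _ _ Hx Hc)); lra. }
  assert ((s - 1) * (x / c) <= x / 2).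
  { apply Rmult_le_reg_r with (2 * c); [lra|].
    replace ((s - 1) * (x / c) * (2 * c)) with ((2 * (s - 1)) * x) by (field; lra).
    replace (x / 2 * (2 * c)) with (c * x) by field.
    unfold c; nra. }
  assert ((s - 1) * (ln x - ln c) <= (s - 1) * (x / c)) by (apply Rmult_le_compat_l; lra).
  lra.
Qed.

(** For [1 <= s] the density is bounded near 0, so one exponential majorant, of total mass at most
    [2 * C], controls both ends of the half line. *)
Lemma Gamma_spec s : 1 <= s ->
  is_RInt_gen (Gamma_density s) (at_right 0) (Rbar_locally p_infty) (Gamma s) /\
  forall a b, 0 < a <= b -> RInt (Gamma_density s) a b <= Gamma s.
Proof.
  intros Hs; destruct (Gamma_density_le s Hs) as [C [HC Hle]].
  destruct (is_RInt_gen_nonneg_bounded (Gamma_density s) (2 * C)) as [l [Hl Hsup]].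
  - intros x Hx; apply Gamma_density_continuous, Hx.
  - intros x _; apply Rlt_le, Gamma_density_pos.
  - intros a b Hab.
    assert (Hint : is_RInt (fun x => C * exp (- x / 2)) a b
       (- 2 * C * exp (- b / 2) - - 2 * C * exp (- a / 2))).
    { apply (is_RInt_derive (fun x => - 2 * C * exp (- x / 2))).
      - intros x _; auto_derive; [exact I|unfold Rdiv; field].
      - intros x _; apply (ex_derive_continuous (K := R_AbsRing) (V := R_NormedModule)).
        auto_derive; exact I. }
    apply Rle_trans with (RInt (fun x => C * exp (- x / 2)) a b).
    + apply RInt_le; [tauto| |exists (- 2 * C * exp (- b / 2) - - 2 * C * exp (- a / 2)); exact Hint|].
      * apply (ex_RInt_continuous (V := R_CompleteNormedModule)); intros z Hz.
        rewrite Rmin_left in Hz by tauto; apply Gamma_density_continuous; lra.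
      * intros x Hx; apply Hle; lra.
    + rewrite (is_RInt_unique _ _ _ _ Hint).
      assert (exp (- a / 2) <= 1) by (rewrite <- exp_0; apply exp_le; lra).
      assert (0 < exp (- b / 2)) by apply exp_pos.
      nra.
  - assert (Gamma s = l) as -> by exact (is_RInt_gen_unique _ _ Hl).
    split; assumption.
Qed.

(** Only the interval [[c, c + 1]] is kept, with the power bounded below at its left end and the
    exponential at its right end. Since [c] is free, [Gamma (1 + r)] outgrows every geometric rate
    in [r]. *)
Lemma Gamma_ge r c : 0 <= r -> 0 < c -> Rpower c r * exp (- (c + 1)) <= Gamma (1 + r).
Proof.
  intros Hr Hc; eapply Rle_trans; [|apply (proj2 (Gamma_spec (1 + r) ltac:(lra)) c (c + 1)); lra].
  replace (Rpower c r * exp (- (c + 1))) with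
    (RInt (fun _ => Rpower c r * exp (- (c + 1))) c (c + 1))
    by (rewrite RInt_const; unfold scal; simpl; unfold mult; simpl; ring).
  apply RInt_le; [lra|apply ex_RInt_const| |].
  - apply (ex_RInt_continuous (V := R_CompleteNormedModule)); intros z Hz.
    rewrite Rmin_left in Hz by lra; apply Gamma_density_continuous; lra.
  - intros x Hx; unfold Gamma_density; replace (1 + r - 1) with r by ring.
    apply Rmult_le_compat; try (apply Rlt_le, exp_pos).
    + apply Rle_Rpower_l; lra.
    + apply exp_le; lra.
Qed.

Lemma Gamma_pos s : 1 <= s -> 0 < Gamma s.
Proof.
  intros Hs; replace s with (1 + (s - 1)) by ring.
  eapply Rlt_le_trans; [|apply (Gamma_ge (s - 1) 1); lra].
  apply Rmult_lt_0_compat; apply exp_pos.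
Qed.

(** Fundamental theorem of calculus on the open half line: limits of the primitive replace its
    boundary values, so nothing is asked of it at 0. *)
Lemma is_RInt_gen_derive_pos (f df : R -> R) (la lb : R) :
  (forall x, 0 < x -> is_derive f x (df x)) -> (forall x, 0 < x -> continuous df x) ->
  filterlim f (at_right 0) (locally la) -> filterlim f (Rbar_locally p_infty) (locally lb) ->
  is_RInt_gen df (at_right 0) (Rbar_locally p_infty) (lb - la).
Proof.
  intros Hd Hc Hla Hlb P HP.
  assert (Hlim : filterlim (fun ab : R * R => f (snd ab) - f (fst ab))
     (filter_prod (at_right 0) (Rbar_locally p_infty)) (locally (lb - la))).
  { apply (filterlim_comp_2 (F := filter_prod (at_right 0) (Rbar_locally p_infty)) (G := locally lb) (H := locally (- la)) (fun ab : R * R => f (snd ab)) (fun ab => - f (fst ab)) Rplus).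
    - apply (filterlim_comp _ _ _ snd f _ (Rbar_locally p_infty)); [apply filterlim_snd|exact Hlb].
    - apply (filterlim_comp _ _ _ (fun ab => f (fst ab)) Ropp _ (locally la)).
      + apply (filterlim_comp _ _ _ fst f _ (at_right 0)); [apply filterlim_fst|exact Hla].
      + apply (filterlim_opp (K := R_AbsRing) (V := R_NormedModule) la).
    - apply (filterlim_plus (K := R_AbsRing) (V := R_NormedModule) lb (- la)). }
  specialize (Hlim P HP); unfold filtermap in Hlim.
  assert (Hpos : filter_prod (at_right 0) (Rbar_locally p_infty)
     (fun ab : R * R => 0 < fst ab /\ 0 < snd ab)).
  { apply (Filter_prod _ _ _ (fun a => 0 < a) (fun b => 0 < b)); [| |simpl; tauto].
    - exists (mkposreal 1 Rlt_0_1); tauto.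
    - exists 0; tauto. }
  generalize (filter_and _ _ Hlim Hpos); unfold filtermapi; apply filter_imp.
  intros [a b] [H [Ha Hb]].
  exists (f b - f a); split; [|exact H].
  simpl in *; assert (0 < Rmin a b) by (apply Rmin_glb_lt; assumption).
  apply (is_RInt_derive f df); intros x Hx; [apply Hd|apply Hc]; lra.
Qed.

Lemma filterlim_squeeze_pos (F : (R -> Prop) -> Prop) (f h : R -> R) : Filter F ->
  F (fun x => 0 <= f x <= h x) -> filterlim h F (locally 0) -> filterlim f F (locally 0).
Proof.
  intros HF Hle Hh P [eps HP].
  assert (Heps : locally 0 (ball 0 eps)) by (exists eps; tauto).
  assert (Hhb : F (fun x => ball 0 eps (h x))) by exact (Hh _ Heps).
  generalize (filter_and _ _ Hle Hhb); unfold filtermap; apply filter_imp; intros x [Hx Hb].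
  apply HP; apply Rabs_def2 in Hb; apply Rabs_def1;
    change (minus (f x) 0) with (f x - 0); change (minus (h x) 0) with (h x - 0) in Hb; lra.
Qed.

Lemma filterlim_exp_half_p_infty C :
  filterlim (fun x => C * exp (- x / 2)) (Rbar_locally p_infty) (locally 0).
Proof.
  assert (H : is_lim (fun x => C * exp (- x / 2)) p_infty (C * 0)); [|now rewrite Rmult_0_r in H].
  apply (is_lim_scal_l (fun x => exp (- x / 2)) C p_infty 0).
  apply (is_lim_comp exp (fun x => - x / 2) p_infty 0 m_infty); [apply is_lim_exp_m| |].
  - intros P [M HM]; exists (- 2 * M); intros x Hx; apply HM; lra.
  - exists 0; intros; discriminate.
Qed.

Lemma Gamma_1 : Gamma 1 = 1.
Proof.
  replace 1 with (0 - - 1) at 2 by ring.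
  apply (is_RInt_gen_unique (V := R_CompleteNormedModule) (Gamma_density 1)).
  apply (is_RInt_gen_derive_pos (fun x => - exp (- x))).
  - intros x Hx; unfold Gamma_density; auto_derive; [exact I|].
    rewrite Rminus_diag, Rpower_O by exact Hx; ring.
  - apply (Gamma_density_continuous 1).
  - apply (filterlim_filter_le_1 (F := locally 0) (G := at_right 0) (H := locally (- 1))
      (fun x => - exp (- x))).
    + intros P [eps HP]; exists eps; intros y Hy _; apply HP, Hy.
    + replace (- 1) with (- exp (- 0)) by (rewrite Ropp_0, exp_0; ring).
      apply (ex_derive_continuous (K := R_AbsRing) (V := R_NormedModule) (fun x => - exp (- x)) 0).
      auto_derive; exact I.
  - assert (H : is_lim (fun x => - exp (- x)) p_infty (- 0)); [|now rewrite Ropp_0 in H].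
    apply (is_lim_opp (fun x => exp (- x)) p_infty 0).
    apply (is_lim_comp exp Ropp p_infty 0 m_infty); [apply is_lim_exp_m| |].
    + intros P [M HM]; exists (- M); intros x Hx; apply HM; lra.
    + exists 0; intros; discriminate.
Qed.

(** Integration by parts: the difference of the two integrands is the derivative of
    [- Gamma_density (s + 1)], which tends to 0 at both ends. *)
Lemma Gamma_S s : 1 <= s -> Gamma (s + 1) = s * Gamma s.
Proof.
  intros Hs; apply Rminus_diag_uniq.
  assert (Hgen : is_RInt_gen (fun x => Gamma_density (s + 1) x - s * Gamma_density s x)
     (at_right 0) (Rbar_locally p_infty) (Gamma (s + 1) - s * Gamma s)).
  { apply (is_RInt_gen_minus (V := R_NormedModule)).
    - apply Gamma_spec; lra.
    - apply (is_RInt_gen_scal (V := R_NormedModule)), Gamma_spec, Hs. }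
  rewrite <- (is_RInt_gen_unique _ _ Hgen).
  replace 0 with (- 0 - - 0) at 2 by ring.
  apply (is_RInt_gen_unique (V := R_CompleteNormedModule)).
  apply (is_RInt_gen_derive_pos (fun x => - Gamma_density (s + 1) x)).
  - intros x Hx; unfold Gamma_density.
    replace (s + 1 - 1) with (s - 1 + 1) by ring.
    unfold Rpower; auto_derive; [exact Hx|].
    rewrite (Rmult_plus_distr_r (s - 1) 1 (ln x)), (Rmult_1_l (ln x)), exp_plus, exp_ln by exact Hx; field; lra.
  - intros x Hx; apply (continuous_minus (V := R_NormedModule));
      [|apply (continuous_scal_r (V := R_NormedModule))]; apply Gamma_density_continuous, Hx.
  - apply (filterlim_comp _ _ _ _ Ropp _ (locally 0));
      [|apply (filterlim_opp (K := R_AbsRing) (V := R_NormedModule) 0)].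
    (* Near 0 the function is [x] times [Rpower x (s - 1) * exp (- x)], and the latter is at most 1
       for [x < 1]. *)
    apply (filterlim_squeeze_pos _ _ (fun x => x)); [apply at_right_proper_filter| |].
    + exists (mkposreal 1 Rlt_0_1); intros x Hx Hx0.
      assert (Rabs (x - 0) < 1) as Hlt by exact Hx; apply Rabs_def2 in Hlt.
      split; [apply Rlt_le, Gamma_density_pos|unfold Gamma_density].
      replace (s + 1 - 1) with (s - 1 + 1) by ring.
      rewrite Rpower_plus, Rpower_1 by exact Hx0.
      assert (Rpower x (s - 1) <= 1).
      { apply Rle_trans with (Rpower 1 (s - 1)); [apply Rle_Rpower_l; lra|].
        rewrite Rpower_1_base; lra. }
      assert (exp (- x) <= 1) by (rewrite <- exp_0; apply exp_le; lra).
      assert (0 < Rpower x (s - 1)) by apply exp_pos.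
      assert (0 < exp (- x)) by apply exp_pos.
      assert (Rpower x (s - 1) * exp (- x) <= 1) by nra.
      nra.
    + intros P [eps HP]; exists eps; intros y Hy _; apply HP, Hy.
  - apply (filterlim_comp _ _ _ _ Ropp _ (locally 0));
      [|apply (filterlim_opp (K := R_AbsRing) (V := R_NormedModule) 0)].
    destruct (Gamma_density_le (s + 1)) as [C [HC Hle]]; [lra|].
    apply (filterlim_squeeze_pos _ _ (fun x => C * exp (- x / 2)));
      [apply Rbar_locally_filter| |apply filterlim_exp_half_p_infty].
    exists 0; intros x Hx; split; [apply Rlt_le, Gamma_density_pos|apply Hle, Hx].
Qed.

(* Integrate the tangent line at [x] of the convex function [t => t ^ p] against the density of [Gamma x]. *)
Lemma Gamma_log_convex x p : 1 <= x -> 1 <= x + p -> p <= 0 \/ 1 <= p ->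
  Rpower x p * Gamma x <= Gamma (x + p).
Proof.
  intros Hx Hxp Hp; apply Rminus_le_0.
  set (c := Rpower x p).
  assert (Hgen : is_RInt_gen (fun t => Gamma_density (x + p) t -
        (c * (1 - p) * Gamma_density x t + c * p / x * Gamma_density (x + 1) t))
     (at_right 0) (Rbar_locally p_infty)
     (Gamma (x + p) - (c * (1 - p) * Gamma x + c * p / x * Gamma (x + 1)))).
  { apply (is_RInt_gen_minus (V := R_NormedModule)); [apply Gamma_spec, Hxp|].
    apply (is_RInt_gen_plus (V := R_NormedModule));
      apply (is_RInt_gen_scal (V := R_NormedModule)), Gamma_spec; lra. }
  (* The functional equation says that the normalised density has mean [x], so the tangent line
     integrates to its value [c] at [x] times [Gamma x]. *)
  rewrite Gamma_S in Hgen by exact Hx.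
  replace (c * (1 - p) * Gamma x + c * p / x * (x * Gamma x)) with (c * Gamma x)
    in Hgen by (field; lra).
  apply (is_RInt_gen_nonneg _ _) in Hgen; [exact Hgen|].
  intros t Ht; unfold Gamma_density.
  replace (x + p - 1) with (x - 1 + p) by ring.
  replace (x + 1 - 1) with (x - 1 + 1) by ring.
  rewrite !Rpower_plus, Rpower_1 by exact Ht.
  assert (H : 1 + p * (t / x - 1) <= Rpower (t / x) p).
  { apply Rpower_bernoulli_ge; [apply Rdiv_lt_0_compat; lra|exact Hp]. }
  assert (Hc : Rpower t p = c * Rpower (t / x) p).
  { unfold c; rewrite Rpower_mult_distr; [f_equal; field|..]; try lra.
    apply Rdiv_lt_0_compat; lra. }
  rewrite Hc.
  replace (_ - _) with ((Rpower t (x - 1) * exp (- t) * c) *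
    (Rpower (t / x) p - (1 + p * (t / x - 1)))) by (field; lra).
  apply Rmult_le_pos; [|lra].
  repeat apply Rmult_le_pos; apply Rlt_le, exp_pos.
Qed.

(** * Power sums against the convolution kernel *)

(** Both sides obey the same first-order recurrence in [n]. This is the closed form of the
    coefficients of [(1 - z)^(-1-s)], written without division. *)
Lemma varrho_Gamma s n : 0 <= s ->
  varrho (1 + s) n * Gamma (1 + s) * Gamma (INR n + 1) = Gamma (INR n + 1 + s).
Proof.
  intros Hs; induction n as [|n IH].
  - simpl; rewrite varrho_0, Rplus_0_l, Gamma_1; ring.
  - rewrite S_INR; assert (Hn := pos_INR n).
    replace (INR n + 1 + 1 + s) with (INR n + 1 + s + 1) by ring.
    rewrite !(Gamma_S (INR n + 1)), (Gamma_S (INR n + 1 + s)), <- IH by lra.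
    generalize (varrho_S (1 + s) n); rewrite S_INR; intros H.
    replace (varrho (1 + s) (S n) * Gamma (1 + s) * ((INR n + 1) * Gamma (INR n + 1)))
      with ((INR n + 1) * varrho (1 + s) (S n) * Gamma (1 + s) * Gamma (INR n + 1)) by ring.
    rewrite H; ring.
Qed.

(** Convexity is applied at [INR k] with exponent [1 + s], which is at least 1 even when [s < 1];
    the surplus factor [INR k] is absorbed by [Gamma (INR k + 1)]. *)
Lemma Rpower_le_varrho s k : 0 <= s -> (1 <= k)%nat ->
  Rpower (INR k) s <= Gamma (1 + s) * varrho (1 + s) k.
Proof.
  intros Hs Hk; assert (H1 : 1 <= INR k) by (apply (le_INR 1), Hk).
  assert (HG := Gamma_pos (INR k) H1).
  apply Rmult_le_reg_r with (INR k * Gamma (INR k)); [nra|].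
  generalize (varrho_Gamma s k Hs); rewrite Gamma_S by exact H1; intros Heq.
  replace (Gamma (1 + s) * varrho (1 + s) k) with
    (varrho (1 + s) k * Gamma (1 + s)) by ring.
  rewrite Heq.
  replace (INR k + 1 + s) with (INR k + (1 + s)) by ring.
  eapply Rle_trans; [|apply Gamma_log_convex; lra].
  rewrite Rpower_plus, Rpower_1 by lra; right; ring.
Qed.

(** Convexity is applied at [INR n + 1 + s] with the exponent [- s], admissible for every [s >= 0];
    this base point is the origin of the shift. *)
Lemma varrho_le_Rpower s n : 0 <= s ->
  Gamma (1 + s) * varrho (1 + s) n <= Rpower (INR n + 1 + s) s.
Proof.
  intros Hs; assert (Hn := pos_INR n).
  assert (HG := Gamma_pos (INR n + 1) ltac:(lra)).
  apply Rmult_le_reg_r with (Gamma (INR n + 1)); [exact HG|].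
  replace (Gamma (1 + s) * varrho (1 + s) n * Gamma (INR n + 1))
    with (Gamma (INR n + 1 + s)) by (rewrite <- varrho_Gamma by exact Hs; ring).
  assert (H : Rpower (INR n + 1 + s) (- s) * Gamma (INR n + 1 + s) <= Gamma (INR n + 1)).
  { eapply Rle_trans; [apply Gamma_log_convex; lra|right; f_equal; ring]. }
  rewrite Rpower_Ropp in H.
  assert (HP := Rpower_pos (INR n + 1 + s) s).
  apply Rmult_le_reg_l with (/ Rpower (INR n + 1 + s) s); [apply Rinv_0_lt_compat, HP|].
  eapply Rle_trans; [exact H|right; field; lra].
Qed.

Lemma varrho_decreasing beta i j : 0 < beta < 1 -> (i <= j)%nat ->
  varrho beta j <= varrho beta i.
Proof.
  intros Hb Hij; induction Hij as [|j Hij IH]; [lra|].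
  apply Rle_trans with (varrho beta j); [|exact IH].
  assert (Hj := pos_INR j); assert (HS := varrho_S beta j); rewrite S_INR in HS.
  assert (0 < varrho beta j) by (apply varrho_pos; lra).
  nra.
Qed.

(** For consecutive indices this is the concave Bernoulli inequality at [t = j / (j + 1)], whose
    right side is exactly the ratio [(beta + j) / (j + 1)] of consecutive coefficients. *)
Lemma Rpower_varrho_increasing beta i j : 0 < beta < 1 -> (1 <= i <= j)%nat ->
  Rpower (INR i) (1 - beta) * varrho beta i <= Rpower (INR j) (1 - beta) * varrho beta j.
Proof.
  intros Hb [Hi Hij]; induction Hij as [|j Hij IH]; [lra|].
  eapply Rle_trans; [exact IH|].
  assert (Hj : 1 <= INR j) by (apply (le_INR 1); lia).
  assert (HS := varrho_S beta j); rewrite S_INR in *.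
  assert (Hv : 0 < varrho beta j) by (apply varrho_pos; lra).
  assert (Hp := Rpower_pos (INR j + 1) (1 - beta)).
  assert (Hq : 0 < INR j / (INR j + 1)) by (apply Rdiv_lt_0_compat; lra).
  assert (H := Rpower_bernoulli_le _ (1 - beta) Hq ltac:(lra)).
  assert (Hd : Rpower (INR j) (1 - beta) =
    Rpower (INR j + 1) (1 - beta) * Rpower (INR j / (INR j + 1)) (1 - beta)).
  { rewrite Rpower_mult_distr by lra; f_equal; field; lra. }
  replace (varrho beta (S j)) with ((beta + INR j) / (INR j + 1) * varrho beta j)
    by (apply Rmult_eq_reg_l with (INR j + 1); [rewrite HS; field; lra|lra]).
  rewrite Hd, Rmult_assoc; apply Rmult_le_compat_l; [lra|].
  apply Rmult_le_compat_r; [lra|].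
  eapply Rle_trans; [exact H|right; field; lra].
Qed.

(** One-sided substitute for the homogeneity of [x^(beta-1)]. *)
Lemma varrho_scale beta m p : 0 < beta < 1 -> (1 <= m)%nat -> (1 <= p)%nat ->
  Rpower (INR m) (beta - 1) * varrho beta p <= varrho beta (m * p).
Proof.
  intros Hb Hm Hp.
  assert (Hm' : 1 <= INR m) by (apply (le_INR 1), Hm).
  assert (Hp' : 1 <= INR p) by (apply (le_INR 1), Hp).
  assert (H := Rpower_varrho_increasing beta p (m * p) Hb ltac:(nia)).
  rewrite mult_INR, <- Rpower_mult_distr in H by lra.
  assert (H1 := Rpower_pos (INR p) (1 - beta)).
  assert (H2 := Rpower_pos (INR m) (1 - beta)).
  replace (beta - 1) with (- (1 - beta)) by ring; rewrite Rpower_Ropp.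
  apply Rmult_le_reg_l with (Rpower (INR m) (1 - beta) * Rpower (INR p) (1 - beta)); [nra|].
  eapply Rle_trans; [|exact H]; right; field; lra.
Qed.

(** The indices from [m] on are cut into blocks [[m * k, m * k + m)], each contributing at least [m]
    times [c k]; the indices below [m] are dropped by nonnegativity. *)
Lemma rsum_blocks m q (c f : nat -> R) : (1 <= m)%nat -> (1 <= q)%nat ->
  (forall j, (1 <= j < m)%nat -> 0 <= f j) ->
  (forall k i, (1 <= k < q)%nat -> (i < m)%nat -> c k <= f (m * k + i)%nat) ->
  INR m * rsum 1 (q - 1) c <= rsum 1 (m * q - 1) f.
Proof.
  intros Hm Hq Hf; induction Hq as [|q Hq IH]; intros H.
  - rewrite rsum_nil, Rmult_0_r, Nat.mul_1_r by lia.
    apply rsum_nonneg; intros i Hi; apply Hf; lia.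
  - replace (S q - 1)%nat with (S (q - 1)) by lia; rewrite rsum_last by lia.
    replace (S (q - 1)) with q by lia.
    assert (Hmq : (1 <= m * q)%nat) by nia.
    rewrite Nat.mul_succ_r, (rsum_chasles 1 (m * q - 1) (m * q + m - 1)) by lia.
    rewrite Rmult_plus_distr_l; apply Rplus_le_compat.
    + apply IH; intros k i Hk Hi; apply H; lia.
    + replace (S (m * q - 1)) with (m * q)%nat by lia.
      eapply Rle_trans; [|apply (rsum_ge_const _ _ (c q))].
      * replace (S (m * q + m - 1) - m * q)%nat with m by lia; lra.
      * lia.
      * intros i Hi; replace i with (m * q + (i - m * q))%nat by lia; apply H; lia.
Qed.

Definition power_sum (beta s : R) (n : nat) : R :=
  rsum 1 (n - 1) (fun k => varrho beta (n - k) * Rpower (INR k) s).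

Lemma power_sum_scale beta s m n : 0 < beta < 1 -> 0 <= s -> (1 <= m)%nat -> (1 <= n)%nat ->
  Rpower (INR m) (s + beta) * power_sum beta s n <= power_sum beta s (m * n).
Proof.
  intros Hb Hs Hm Hn; unfold power_sum.
  assert (Hm' : 1 <= INR m) by (apply (le_INR 1), Hm).
  (* A lower bound for every term of block [k]: [varrho] decreases and
     [m * n - (m * k + i) <= m * (n - k)], while [(m * k + i)^s >= m^s * k^s]. The [m] terms of a
     block supply the missing factor [m]. *)
  set (c := fun k => Rpower (INR m) (s + beta - 1) * (varrho beta (n - k) * Rpower (INR k) s)).
  apply Rle_trans with (INR m * rsum 1 (n - 1) c).
  - unfold c; rewrite rsum_scal, <- Rmult_assoc.
    replace (s + beta) with (1 + (s + beta - 1)) at 1 by ring.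
    rewrite (Rpower_plus 1), Rpower_1 by lra; lra.
  - apply rsum_blocks; [exact Hm|exact Hn| |].
    + intros j Hj; apply Rmult_le_pos; apply Rlt_le; [apply varrho_pos; lra|apply Rpower_pos].
    + intros k i Hk Hi; unfold c.
      assert (Hk' : 1 <= INR k) by (apply (le_INR 1); lia).
      replace (s + beta - 1) with (s + (beta - 1)) by ring; rewrite Rpower_plus.
      replace (Rpower (INR m) s * Rpower (INR m) (beta - 1) * (varrho beta (n - k) * Rpower (INR k) s))
        with ((Rpower (INR m) (beta - 1) * varrho beta (n - k)) * (Rpower (INR m) s * Rpower (INR k) s))
        by ring.
      rewrite Rpower_mult_distr, <- mult_INR by lra.
      apply Rmult_le_compat.
      * apply Rlt_le, Rmult_lt_0_compat; [apply Rpower_pos|apply varrho_pos; lra].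
      * apply Rlt_le, Rpower_pos.
      * eapply Rle_trans; [apply varrho_scale; [exact Hb|exact Hm|lia]|].
        apply varrho_decreasing; [exact Hb|nia].
      * apply Rle_Rpower_l; [exact Hs|split; [apply lt_0_INR; nia|apply le_INR; lia]].
Qed.

(** Each [k^s] is replaced by a coefficient of [(1 - z)^(-1-s)]; adding the nonnegative terms
    [k = 0] and [k = n] completes a Vandermonde convolution. *)
Lemma power_sum_le_shifted beta s n : 0 < beta < 1 -> 0 <= s ->
  power_sum beta s n * Gamma (1 + (s + beta)) <=
    Gamma (1 + s) * Rpower (INR n + 1 + (s + beta)) (s + beta).
Proof.
  intros Hb Hs.
  assert (HG := Gamma_pos (1 + (s + beta)) ltac:(lra)).
  assert (HG' := Gamma_pos (1 + s) ltac:(lra)).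
  apply Rle_trans with (Gamma (1 + s) * varrho (1 + (s + beta)) n * Gamma (1 + (s + beta))).
  - apply Rmult_le_compat_r; [lra|].
    replace (1 + (s + beta)) with (beta + (1 + s)) by ring.
    rewrite <- varrho_vandermonde, <- rsum_scal; unfold power_sum.
    apply Rle_trans with (rsum 1 (n - 1)
      (fun k => Gamma (1 + s) * (varrho beta (n - k) * varrho (1 + s) k))).
    + apply rsum_le; intros k Hk.
      assert (H := Rpower_le_varrho s k Hs ltac:(lia)).
      assert (0 < varrho beta (n - k)) by (apply varrho_pos; lra).
      nra.
    + assert (Hpos : forall k, 0 <= Gamma (1 + s) * (varrho beta (n - k) * varrho (1 + s) k)).
      { intros k; apply Rlt_le, Rmult_lt_0_compat, Rmult_lt_0_compat;
          [exact HG'|apply varrho_pos; lra..]. }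
      rewrite (rsum_chasles 0 0 n), rsum_single by lia.
      destruct n as [|n].
      { simpl (0 - 1)%nat; rewrite !(rsum_nil 1 0) by lia; generalize (Hpos 0%nat); simpl; lra. }
      rewrite (rsum_last 1) by lia; replace (S n - 1)%nat with n by lia.
      generalize (Hpos 0%nat) (Hpos (S n)); lra.
  - rewrite (Rmult_assoc (Gamma (1 + s))).
    apply Rmult_le_compat_l; [lra|].
    rewrite Rmult_comm; apply varrho_le_Rpower; lra.
Qed.

(* Discrete counterpart of the Beta integral of [(n - x)^(beta-1) x^s] over [0, n]; refining the grid by [m] and letting [m -> oo] removes the shift in [power_sum_le_shifted]. *)
Lemma power_sum_le beta s n : 0 < beta < 1 -> 0 <= s -> (1 <= n)%nat ->
  power_sum beta s n * Gamma (1 + (s + beta)) <= Gamma (1 + s) * Rpower (INR n) (s + beta).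
Proof.
  intros Hb Hs Hn; set (r := s + beta).
  assert (Hn' : 1 <= INR n) by (apply (le_INR 1), Hn).
  (* The shifted bound at [m * n] divided by [m^r], as a function of [e = 1 / m]; below, [S m]
     stands for [m] so that the inverse makes sense. *)
  set (h := fun e => Gamma (1 + s) * Rpower (INR n + (1 + r) * e) r).
  assert (Hh : is_lim_seq (fun m => h (/ INR (S m))) (h 0)).
  { apply (is_lim_seq_continuous h (fun m => / INR (S m))).
    - apply continuity_pt_filterlim; unfold h.
      apply (ex_derive_continuous (K := R_AbsRing) (V := R_NormedModule) h 0).
      unfold h, Rpower; auto_derive; lra.
    - apply (is_lim_seq_incr_1 (fun m => / INR m)).
      apply (is_lim_seq_inv INR p_infty); [apply is_lim_seq_INR|discriminate]. }
  assert (H0 : h 0 = Gamma (1 + s) * Rpower (INR n) r)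
    by (unfold h; now rewrite Rmult_0_r, Rplus_0_r).
  rewrite <- H0.
  apply (is_lim_seq_le (fun _ => power_sum beta s n * Gamma (1 + r))
    (fun m => h (/ INR (S m))) (Finite _) (Finite _));
    [|apply is_lim_seq_const|exact Hh].
  intros m; unfold h.
  assert (Hm : 1 <= INR (S m)) by (apply (le_INR 1); lia).
  assert (Hsc := power_sum_scale beta s (S m) n Hb Hs ltac:(lia) Hn).
  assert (Hsh := power_sum_le_shifted beta s (S m * n) Hb Hs).
  fold r in Hsc, Hsh; rewrite mult_INR in Hsh.
  assert (HG := Gamma_pos (1 + r) ltac:(unfold r; lra)).
  assert (Hp := Rpower_pos (INR (S m)) r).
  apply Rmult_le_reg_l with (Rpower (INR (S m)) r); [exact Hp|].
  apply Rle_trans with (Gamma (1 + s) * Rpower (INR (S m) * INR n + 1 + r) r).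
  - eapply Rle_trans; [|exact Hsh]; nra.
  - replace (INR (S m) * INR n + 1 + r) with
      (INR (S m) * (INR n + (1 + r) * / INR (S m))) by (field; lra).
    rewrite <- Rpower_mult_distr; [right; ring|lra|].
    assert (0 < (1 + r) * / INR (S m)); [|lra].
    apply Rmult_lt_0_compat; [unfold r; lra|apply Rinv_0_lt_compat; lra].
Qed.

(** * Mittag-Leffler function *)

Lemma Pcoef_pos beta tau j : 0 < beta -> 0 < Pcoef beta tau j.
Proof. intros Hb; apply Rmult_lt_0_compat; [apply Rpower_pos|apply varrho_pos, Hb]. Qed.

Definition ML_term (beta z : R) (l : nat) : R := z ^ l / Gamma (1 + INR l * beta).

Lemma ML_term_nonneg beta z l : 0 < beta -> 0 <= z -> 0 <= ML_term beta z l.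
Proof.
  intros Hb Hz; apply Rmult_le_pos; [apply pow_le, Hz|].
  apply Rlt_le, Rinv_0_lt_compat, Gamma_pos; assert (H := pos_INR l); nra.
Qed.

Lemma Rpower_pow_mul x p l : Rpower x p ^ l = Rpower x (INR l * p).
Proof. rewrite <- Rpower_pow by apply Rpower_pos; rewrite Rpower_mult; f_equal; ring. Qed.

Lemma ML_ex_series beta z : 0 < beta -> 0 <= z -> ex_series (ML_term beta z).
Proof.
  (* Chosen so that [c^beta = 2 * z + 1]: then [Gamma_ge] bounds the terms by a geometric series of
     ratio [z / (2 * z + 1) < 1]. *)
  intros Hb Hz; set (c := Rpower (2 * z + 1) (/ beta)).
  assert (Hc : 0 < c) by apply Rpower_pos.
  assert (Hq : Rabs (z / (2 * z + 1)) < 1).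
  { rewrite Rabs_pos_eq; [|apply Rmult_le_pos; [lra|apply Rlt_le, Rinv_0_lt_compat; lra]].
    apply Rmult_lt_reg_r with (2 * z + 1); [lra|].
    replace (z / (2 * z + 1) * (2 * z + 1)) with z by (field; lra); lra. }
  apply (ex_series_le (K := R_AbsRing) (V := R_CompleteNormedModule) _
    (fun l => exp (c + 1) * (z / (2 * z + 1)) ^ l)).
  - intros l; change (Rabs (ML_term beta z l) <= exp (c + 1) * (z / (2 * z + 1)) ^ l).
    rewrite Rabs_pos_eq by (apply ML_term_nonneg; assumption).
    assert (HG := Gamma_ge (INR l * beta) c ltac:(assert (H := pos_INR l); nra) Hc).
    unfold c in HG at 1; rewrite Rpower_mult in HG.
    replace (/ beta * (INR l * beta)) with (INR l) in HG by (field; lra).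
    rewrite Rpower_pow in HG by lra.
    unfold ML_term, Rdiv; rewrite Rpow_mult_distr, pow_inv.
    replace (exp (c + 1) * (z ^ l * / (2 * z + 1) ^ l)) with
      (z ^ l * / ((2 * z + 1) ^ l * exp (- (c + 1)))).
    + apply Rmult_le_compat_l; [apply pow_le, Hz|].
      apply Rinv_le_contravar; [|exact HG].
      apply Rmult_lt_0_compat; [apply pow_lt; lra|apply exp_pos].
    + rewrite exp_Ropp; field; split; [apply pow_nonzero; lra|].
      apply Rgt_not_eq, exp_pos.
  - apply (ex_series_scal_l (K := R_AbsRing) (V := R_NormedModule) (exp (c + 1))).
    eexists; apply is_series_geom, Hq.
Qed.

Lemma ML_ex_series_S beta z : 0 < beta -> 0 <= z -> ex_series (fun l => ML_term beta z (S l)).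
Proof.
  intros Hb Hz.
  apply (proj1 (ex_series_incr_1 (K := R_AbsRing) (V := R_NormedModule) (ML_term beta z))).
  apply ML_ex_series; assumption.
Qed.

Lemma ML_monotone beta y z : 0 < beta -> 0 <= y <= z ->
  MittagLeffler beta y <= MittagLeffler beta z.
Proof.
  intros Hb Hyz; apply Series_le; [|apply ML_ex_series; lra].
  intros l; split; [apply ML_term_nonneg; lra|].
  apply Rmult_le_compat_r; [|apply pow_incr, Hyz].
  apply Rlt_le, Rinv_0_lt_compat, Gamma_pos; assert (H := pos_INR l); nra.
Qed.

Lemma ML_incr_1 beta z : 0 < beta -> 0 <= z ->
  MittagLeffler beta z = 1 + Series (fun l => ML_term beta z (S l)).
Proof.
  intros Hb Hz; unfold MittagLeffler; fold (ML_term beta z).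
  rewrite (Series_incr_1 (ML_term beta z)) by (apply ML_ex_series; assumption).
  f_equal; unfold ML_term; simpl; rewrite Rmult_0_l, Rplus_0_r, Gamma_1; field.
Qed.

Lemma ML_ge_1 beta z : 0 < beta -> 0 <= z -> 1 <= MittagLeffler beta z.
Proof.
  intros Hb Hz; rewrite ML_incr_1 by assumption.
  assert (0 <= Series (fun l => ML_term beta z (S l))); [|lra].
  rewrite <- (Rmult_0_l (Series (fun l => ML_term beta z (S l)))), <- Series_scal_l.
  apply Series_le; [|apply ML_ex_series_S; assumption].
  intros l; assert (H := ML_term_nonneg beta z (S l) Hb Hz); lra.
Qed.

Lemma is_series_rsum a b (c : nat -> R) (u : nat -> nat -> R) :
  (forall k, ex_series (u k)) ->
  is_series (fun l => rsum a b (fun k => c k * u k l))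
    (rsum a b (fun k => c k * Series (u k))).
Proof.
  intros Hu; unfold rsum; induction (seq a (S b - a)) as [|k s IH]; simpl.
  - change (is_lim_seq (sum_n (fun _ => 0)) 0).
    apply (is_lim_seq_ext (fun _ => 0)); [|apply is_lim_seq_const].
    intros m; rewrite sum_n_const; ring.
  - apply (is_series_plus (K := R_AbsRing) (V := R_NormedModule)); [|exact IH].
    apply (is_series_scal_l (K := R_AbsRing) (V := R_NormedModule)), Series_correct, Hu.
Qed.

(** Term [l] on the left is compared with term [S l] on the right, since the prefactor
    [mu * tau^beta] raises the degree by one; the constant term accounts for the [- 1]. *)
Lemma sum_Pcoef_ML beta tau mu n : 0 < beta < 1 -> 0 < tau -> 0 <= mu -> (1 <= n)%nat ->
  mu * rsum 1 (n - 1) (fun k =>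
      Pcoef beta tau (n - k) * MittagLeffler beta (mu * Rpower (INR k * tau) beta))
    <= MittagLeffler beta (mu * Rpower (INR n * tau) beta) - 1.
Proof.
  intros Hb Ht Hmu Hn.
  assert (Hz : forall k, 0 <= mu * Rpower (INR k * tau) beta)
    by (intros k; apply Rmult_le_pos; [exact Hmu|apply Rlt_le, Rpower_pos]).
  assert (Hser := is_series_rsum 1 (n - 1) (fun k => mu * Pcoef beta tau (n - k))
    (fun k => ML_term beta (mu * Rpower (INR k * tau) beta))
    (fun k => ML_ex_series _ _ (proj1 Hb) (Hz k))).
  rewrite ML_incr_1 by (lra || apply Hz).
  rewrite Rplus_minus_l, <- rsum_scal.
  rewrite (rsum_ext _ _ _ (fun k => mu * Pcoef beta tau (n - k) *
    Series (ML_term beta (mu * Rpower (INR k * tau) beta))))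
    by (intros; unfold MittagLeffler, ML_term; ring).
  rewrite <- (is_series_unique _ _ Hser).
  apply Series_le;
    [|apply ML_ex_series_S; [lra|apply Hz]].
  intros l; split.
  - apply rsum_nonneg; intros k _; apply Rmult_le_pos; [|apply ML_term_nonneg; [lra|apply Hz]].
    apply Rmult_le_pos, Rlt_le, Pcoef_pos; lra.
  - assert (Hl := pos_INR l); assert (Hlb : 0 <= INR l * beta) by nra.
    assert (HG := Gamma_pos (1 + INR l * beta) ltac:(lra)).
    assert (HG' := Gamma_pos (1 + (INR l * beta + beta)) ltac:(lra)).
    assert (H := power_sum_le beta (INR l * beta) n Hb Hlb Hn).
    assert (Hn' : 1 <= INR n) by (apply (le_INR 1), Hn).
    assert (Hterm : forall k j, 0 < INR k -> ML_term beta (mu * Rpower (INR k * tau) beta) j =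
      mu ^ j * Rpower tau (INR j * beta) * Rpower (INR k) (INR j * beta) / Gamma (1 + INR j * beta)).
    { intros k j Hk; unfold ML_term; rewrite Rpow_mult_distr, Rpower_pow_mul.
      rewrite <- Rpower_mult_distr by assumption; field.
      apply Rgt_not_eq, Gamma_pos; assert (H' := pos_INR j); nra. }
    (* Common factor of both sides; what remains is [power_sum_le] with [s = INR l * beta]. *)
    set (K := mu ^ S l * Rpower tau (INR l * beta + beta)).
    assert (HK : 0 <= K)
      by (apply Rmult_le_pos; [apply pow_le, Hmu|apply Rlt_le, Rpower_pos]).
    rewrite Hterm by lra.
    rewrite (rsum_ext _ _ _ (fun k => K / Gamma (1 + INR l * beta) *
      (varrho beta (n - k) * Rpower (INR k) (INR l * beta)))).
    + rewrite rsum_scal; fold (power_sum beta (INR l * beta) n).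
      rewrite S_INR; replace ((INR l + 1) * beta) with (INR l * beta + beta) by ring; fold K.
      apply Rmult_le_reg_r with (Gamma (1 + INR l * beta) * Gamma (1 + (INR l * beta + beta)));
        [nra|].
      eapply Rle_trans; [|eapply Rle_trans; [apply (Rmult_le_compat_l K _ _ HK H)|]];
        right; field; lra.
    + intros k Hk; rewrite Hterm by (apply lt_0_INR; lia).
      unfold K, Pcoef; rewrite Rpower_plus; simpl; field; lra.
Qed.

(** * Gronwall inequality *)

Lemma shifted_nonneg theta w k : 0 <= theta <= 1 -> 0 <= w k -> 0 <= w (k - 1)%nat ->
  0 <= shifted theta w k.
Proof. intros Ht H1 H2; unfold shifted; nra. Qed.

(* When [v n] dominates all previous values, every term of the inequality convolved with [P] carries a factor [v n] that can be cancelled; the term [P_0 lam_0 v n] is absorbed using [2 Lam tau^beta <= 1]. *)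
Lemma gronwall_dominant_step (beta tau theta : R) (g lam : nat -> R) (Lam : R) (v : nat -> R)
  (F : nat -> R) (Psi : R) (n : nat) :
  0 < beta -> 0 <= theta <= 1 -> (1 <= n)%nat ->
  (forall k, (k <= n)%nat -> 0 <= g k) ->
  (forall l, (l < n)%nat -> 0 <= lam l) ->
  (forall k, (1 <= k <= n)%nat -> rsum 0 (k - 1) lam <= Lam) ->
  2 * Lam * Rpower tau beta <= 1 ->
  (forall k, (k <= n)%nat -> 0 <= v k) ->
  (forall k, (1 <= k <= n)%nat ->
     Dfrac beta tau (fun j => v j ^ 2) k
       <= rsum 1 k (fun l => lam (k - l)%nat * v l ^ 2)
          + shifted theta v k * shifted theta g k) ->
  (forall j, (j < n)%nat -> v j < v n) ->
  (forall l k, (1 <= l <= k)%nat -> (k < n)%nat -> v l <= F k) ->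
  v 0%nat + rsum 1 n (fun j => Pcoef beta tau (n - j) * shifted theta g j)
    + Lam * rsum 1 (n - 1) (fun k => Pcoef beta tau (n - k) * F k) <= Psi ->
  v n <= 2 * Psi.
Proof.
  intros Hb Hth Hn Hg Hlam HLam Htau Hv Hineq Hdom HF HPsi.
  assert (H0 := Hv 0%nat ltac:(lia)); assert (Hvn := Hdom 0%nat ltac:(lia)).
  assert (Hle : forall j, (j <= n)%nat -> v j <= v n).
  { intros j Hj; destruct (Nat.eq_dec j n) as [->|Hjn]; [lra|].
    apply Rlt_le, Hdom; lia. }
  (* [F] bounds the sequence only at indices below [n]; at [n] itself [v n] is the bound. *)
  set (F' := fun k => if Nat.eq_dec k n then v n else F k).
  assert (HF' : forall l k, (1 <= l <= k)%nat -> (k <= n)%nat -> v l <= F' k).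
  { intros l k Hl Hk; unfold F'; destruct (Nat.eq_dec k n) as [->|Hkn];
      [apply Hle; lia|apply HF; lia]. }
  assert (HD : forall k, (1 <= k <= n)%nat ->
    Dfrac beta tau (fun j => v j ^ 2) k <= v n * (Lam * F' k + shifted theta g k)).
  { intros k Hk; eapply Rle_trans; [apply Hineq, Hk|].
    assert (HFk : 0 <= F' k) by (eapply Rle_trans; [apply (Hv k); lia|apply HF'; lia]).
    rewrite Rmult_plus_distr_l; apply Rplus_le_compat.
    (* In each [v l ^ 2] one factor is bounded by [v n], the other by [F' k]; reversing the order of
       summation exposes the partial sum of [lam]. *)
    - apply Rle_trans with (v n * F' k * rsum 0 (k - 1) lam).
      + rewrite <- rsum_rev, <- rsum_scal.
        replace k with (S (k - 1)) at 1 by lia; rewrite rsum_shift.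
        apply rsum_le; intros i Hi.
        replace (k - S i)%nat with (k - 1 - i)%nat by lia.
        assert (0 <= lam (k - 1 - i)%nat) by (apply Hlam; lia).
        assert (v (S i) ^ 2 <= v n * F' k); [|nra].
        simpl; rewrite Rmult_1_r.
        apply Rmult_le_compat; try (apply Hv; lia); [apply Hle; lia|apply HF'; lia].
      + replace (v n * (Lam * F' k)) with (v n * F' k * Lam) by ring.
        apply Rmult_le_compat_l; [nra|apply HLam, Hk].
    - apply Rmult_le_compat_r.
      + apply shifted_nonneg; [exact Hth|apply Hg; lia..].
      + assert (H1 := Hle k ltac:(lia)); assert (H2 := Hle (k - 1)%nat ltac:(lia)).
        unfold shifted; nra. }
  assert (Hsum : v n ^ 2 - v 0%nat ^ 2 <= v n *
    (Lam * rsum 1 n (fun k => Pcoef beta tau (n - k) * F' k)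
     + rsum 1 n (fun k => Pcoef beta tau (n - k) * shifted theta g k))).
  { rewrite <- (sum_Pcoef_Dfrac beta tau (fun j => v j ^ 2) n).
    rewrite <- rsum_scal, <- rsum_plus, <- rsum_scal.
    apply rsum_le; intros k Hk.
    apply Rle_trans with (Pcoef beta tau (n - k) * (v n * (Lam * F' k + shifted theta g k)));
      [|right; ring].
    apply Rmult_le_compat_l; [apply Rlt_le, Pcoef_pos, Hb|apply HD, Hk]. }
  assert (HlastF : rsum 1 n (fun k => Pcoef beta tau (n - k) * F' k) =
    rsum 1 (n - 1) (fun k => Pcoef beta tau (n - k) * F k) + Rpower tau beta * v n).
  { rewrite (rsum_chasles 1 (n - 1) n) by lia.
    replace (S (n - 1)) with n by lia; rewrite rsum_single; f_equal.
    - apply rsum_ext; intros k Hk; unfold F'; destruct (Nat.eq_dec k n); [lia|reflexivity].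
    - unfold F', Pcoef; destruct (Nat.eq_dec n n); [|lia].
      rewrite Nat.sub_diag, varrho_0; ring. }
  rewrite HlastF in Hsum.
  revert Hsum HPsi.
  generalize (rsum 1 (n - 1) (fun k => Pcoef beta tau (n - k) * F k)).
  generalize (rsum 1 n (fun k => Pcoef beta tau (n - k) * shifted theta g k)).
  intros Y X Hsum HPsi.
  (* Division by [v n] is legitimate because [v n > v 0 >= 0]. *)
  assert (Hdiv : v n <= v 0%nat + Lam * (X + Rpower tau beta * v n) + Y).
  { apply Rmult_le_reg_l with (v n); [lra|].
    assert (v 0%nat ^ 2 <= v n * v 0%nat) by (simpl; nra).
    simpl in *; lra. }
  assert (2 * Lam * Rpower tau beta * v n <= v n) by nra.
  lra.
Qed.

Theorem theorem2p1
  (beta T : R) (nT : nat) (theta : R) (g lam : nat -> R) (Lam : R) (v : nat -> R)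
  (hbeta : 0 < beta < 1) (hT : 0 < T) (hnT : (1 <= nT)%nat)
  (htheta : 0 <= theta <= 1)
  (hg : forall k, (k <= nT)%nat -> 0 <= g k)
  (hlam : forall l, (l < nT)%nat -> 0 <= lam l)
  (hLam : forall k, (1 <= k <= nT)%nat -> rsum 0 (k - 1) lam <= Lam)
  (htau : 2 * Lam * (1 + beta) * Rpower (T / INR nT) beta <= 1)
  (hv : forall k, (k <= nT)%nat -> 0 <= v k)
  (hineq : forall k, (1 <= k <= nT)%nat ->
     Dfrac beta (T / INR nT) (fun j => v j ^ 2) k
       <= rsum 1 k (fun l => lam (k - l)%nat * v l ^ 2)
          + shifted theta v k * shifted theta g k) :
  forall k, (1 <= k <= nT)%nat ->
    v k <= 2 * MittagLeffler beta (2 * Lam * Rpower (INR k * (T / INR nT)) beta)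
             * (v 0%nat + rmax1 k (fun m =>
                  rsum 1 m (fun j => Pcoef beta (T / INR nT) (m - j) * shifted theta g j))).
Proof.
  assert (Htau : 0 < T / INR nT) by (apply Rdiv_lt_0_compat; [exact hT|apply lt_0_INR; lia]).
  revert htau hineq Htau; generalize (T / INR nT); intros tau htau hineq Htau.
  assert (HLam : 0 <= Lam).
  { apply Rle_trans with (rsum 0 (1 - 1) lam); [|apply hLam; lia].
    apply rsum_nonneg; intros i Hi; apply hlam; lia. }
  set (E := fun k => MittagLeffler beta (2 * Lam * Rpower (INR k * tau) beta)).
  set (G := fun m => rsum 1 m (fun j => Pcoef beta tau (m - j) * shifted theta g j)).
  assert (HE1 : forall k, 1 <= E k).
  { intros k; apply ML_ge_1; [lra|].
    apply Rmult_le_pos; [lra|apply Rlt_le, Rpower_pos]. }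
  assert (HEmono : forall j k, (1 <= j <= k)%nat -> E j <= E k).
  { intros j k Hjk; apply ML_monotone; [lra|split].
    - apply Rmult_le_pos; [lra|apply Rlt_le, Rpower_pos].
    - apply Rmult_le_compat_l; [lra|apply Rle_Rpower_l; [lra|split]].
      + apply Rmult_lt_0_compat; [apply lt_0_INR; lia|exact Htau].
      + apply Rmult_le_compat_r; [lra|apply le_INR; lia]. }
  assert (HG : forall m, (m <= nT)%nat -> 0 <= G m).
  { intros m Hm; apply rsum_nonneg; intros j Hj; apply Rmult_le_pos;
      [apply Rlt_le, Pcoef_pos; lra|].
    apply shifted_nonneg; [exact htheta|apply hg; lia..]. }
  assert (HPsi : forall k, (1 <= k <= nT)%nat -> v 0%nat <= v 0%nat + rmax1 k G).
  { intros k Hk; assert (H := rmax1_ge k G k ltac:(lia)).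
    generalize (HG k ltac:(lia)); lra. }
  assert (Hv0 := hv 0%nat ltac:(lia)).
  intros n; induction n as [n IH] using lt_wf_ind; intros Hn.
  change (v n <= 2 * E n * (v 0%nat + rmax1 n G)).
  (* The maximum is frozen at [n], so that the bracket is a constant that factors out of the
     convolution and only [E k] varies. *)
  assert (Hbound : forall l k, (1 <= l <= k)%nat -> (k <= n)%nat -> (l < n)%nat ->
     v l <= 2 * E k * (v 0%nat + rmax1 n G)).
  { intros l k Hl Hk Hln; eapply Rle_trans; [apply IH; lia|].
    change (2 * E l * (v 0%nat + rmax1 l G) <= 2 * E k * (v 0%nat + rmax1 n G)).
    assert (H1 := HE1 l); assert (H2 := HEmono l k Hl).
    assert (H3 := HPsi l ltac:(lia)); assert (H4 := rmax1_monotone l n G ltac:(lia)).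
    apply Rmult_le_compat; lra. }
  destruct (classic (exists j, (j < n)%nat /\ v n <= v j)) as [[j [Hj Hvj]]|Hdom].
  - eapply Rle_trans; [exact Hvj|].
    destruct j as [|j]; [|apply Hbound; lia].
    assert (H1 := HE1 n); assert (H2 := HPsi n Hn); nra.
  - replace (2 * E n * (v 0%nat + rmax1 n G)) with (2 * (E n * (v 0%nat + rmax1 n G))) by ring.
    apply (gronwall_dominant_step beta tau theta g lam Lam v
      (fun k => 2 * E k * (v 0%nat + rmax1 n G)) _ n).
    + lra.
    + exact htheta.
    + lia.
    + intros k Hk; apply hg; lia.
    + intros l Hl; apply hlam; lia.
    + intros k Hk; apply hLam; lia.
    (* The step-size condition gives [2 * Lam * tau^beta <= 1] because [1 + beta >= 1]. *)
    + assert (H := Rpower_pos tau beta).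
      assert (0 <= Lam * Rpower tau beta) by nra; nra.
    + intros k Hk; apply hv; lia.
    + intros k Hk; apply hineq; lia.
    + intros j Hj; apply Rnot_le_lt; intros Hvj; apply Hdom; now exists j.
    + intros l k Hl Hk; apply Hbound; lia.
    (* With [B] the bracket and [mu = 2 * Lam], the convolution term is at most [(E n - 1) * B], and
       [v 0 + G n <= B]; together they give [E n * B]. *)
    + assert (HS := sum_Pcoef_ML beta tau (2 * Lam) n hbeta Htau ltac:(lra) ltac:(lia)).
      change (2 * Lam * rsum 1 (n - 1) (fun k => Pcoef beta tau (n - k) * E k) <= E n - 1) in HS.
      rewrite (rsum_ext 1 (n - 1) _ (fun k => (2 * (v 0%nat + rmax1 n G)) *
         (Pcoef beta tau (n - k) * E k))) by (intros; ring).
      rewrite rsum_scal; change (rsum 1 n _) with (G n).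
      assert (H1 := HPsi n Hn); assert (H2 := rmax1_ge n G n ltac:(lia)).
      revert HS; generalize (rsum 1 (n - 1) (fun k => Pcoef beta tau (n - k) * E k)).
      intros X HS; nra.
Qed.
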